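(* Let $\mathcal{A}=(Q,X,E)$ be a letter transducer with $m$ states and $n$ letters, with fixed orderings of $Q$ and $X$. Let $\mathcal{Y}_{\mathcal A}$ be its associated interleaved array and $(\mathcal{P}^1_{\mathcal A},\mathcal{P}^2_{\mathcal A},\mathcal{P}^3_{\mathcal A},\mathcal{P}^4_{\mathcal A})$ its associated proper rete. Then the following hold. (1) $\mathcal{A}$ is Mealy if and only if $\mathcal{Y}_{\mathcal A}$ has property $\mathfrak{UT}(12)$, if and only if $\mathcal{P}^1_{\mathcal A}\perp\mathcal{P}^2_{\mathcal A}$. (2) $\mathcal{A}$ is invertible if and only if $\mathcal{Y}_{\mathcal A}$ has property $\mathfrak{UT}(41)$, if and only if $\mathcal{P}^1_{\mathcal A}\perp\mathcal{P}^4_{\mathcal A}$. (3) $\mathcal{A}$ is reversible if and only if $\mathcal{Y}_{\mathcal A}$ has property $\mathfrak{UT}(23)$, if and only if $\mathcal{P}^2_{\mathcal A}\perp\mathcal{P}^3_{\mathcal A}$. (4) $\mathcal{A}$ is coreversible if and only if $\mathcal{Y}_{\mathcal A}$ has property $\mathfrak{UT}(34)$, if and only if $\mathcal{P}^3_{\mathcal A}\perp\mathcal{P}^4_{\mathcal A}$.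
   Context: $m,n$ are positive integers and $[d]=\{1,\dots,d\}$. A letter transducer is a triple $\mathcal{A}=(Q,X,E)$ with $Q$ a finite set (states), $X$ a finite set (letters), and $E\subseteq Q\times X\times Q\times X$ (transitions). Fix orderings $(q_1,\dots,q_m)$ of $Q$ and $(x_1,\dots,x_n)$ of $X$. $\mathcal{A}$ is: Mealy if for all $q\in Q,x\in X$ there is exactly one element of $E$ of the form $(q,x,\cdot,\cdot)$; invertible if for all $q\in Q,y\in X$ there is exactly one element of $E$ of the form $(q,\cdot,\cdot,y)$; reversible if for all $x\in X,r\in Q$ there is exactly one element of $E$ of the form $(\cdot,x,r,\cdot)$; coreversible if for all $r\in Q,y\in X$ there is exactly one element of $E$ of the form $(\cdot,\cdot,r,y)$. The associated interleaved array is $\mathcal{Y}_{\mathcal A}=\{(i,j,k,\ell)\in[m]\times[n]\times[m]\times[n] : (q_i,x_j,q_k,x_\ell)\in E\}$. The associated proper rete consists of four ordered partitions of $\mathcal{Y}_{\mathcal A}$ (cells may be empty): $\mathcal{P}^s_{\mathcal A}=\{P^s_h\}_h$ with $P^s_h=\{y\in\mathcal{Y}_{\mathcal A}: y_s=h\}$, where $h$ ranges over $[m]$ for $s\in\{1,3\}$ and over $[n]$ for $s\in\{2,4\}$. For distinct $s,t\in\{1,2,3,4\}$, $\mathcal{Y}_{\mathcal A}$ has property $\mathfrak{UT}(st)$ if $|\mathcal{Y}_{\mathcal A}|=mn$ and for all $y,z\in\mathcal{Y}_{\mathcal A}$, $y_s=z_s$ and $y_t=z_t$ imply $y=z$. Two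 indexed partitions $\mathcal{P}=\{P_i\}$, $\mathcal{Q}=\{Q_j\}$ of a common set are orthogonal, $\mathcal{P}\perp\mathcal{Q}$, if $|P_i\cap Q_j|=1$ for all cells $P_i,Q_j$ (for all indices, including those of possibly empty cells). *)

(* Defs.v *)
From mathcomp Require Import all_boot.

Set Implicit Arguments.
Unset Strict Implicit.
Unset Printing Implicit Defensive.

Record letter_transducer := LetterTransducer {
  states : finType;
  letters : finType;
  transitions : {set states * letters * states * letters}
}.

Section Transducers.
Variable A : letter_transducer.

Definition source (e : states A * letters A * states A * letters A) := e.1.1.1.
Definition input (e : states A * letters A * states A * letters A) := e.1.1.2.
Definition target (e : states A * letters A * states A * letters A) := e.1.2.
Definition output (e : states A * letters A * states A * letters A) := e.2.

Definition mealy : Prop := forall (q : states A) (x : letters A),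
  exists! e, [/\ e \in transitions A, source e = q & input e = x].

Definition invertible : Prop := forall (q : states A) (y : letters A),
  exists! e, [/\ e \in transitions A, source e = q & output e = y].

Definition reversible : Prop := forall (x : letters A) (r : states A),
  exists! e, [/\ e \in transitions A, input e = x & target e = r].

Definition coreversible : Prop := forall (r : states A) (y : letters A),
  exists! e, [/\ e \in transitions A, target e = r & output e = y].

End Transducers.

Inductive position := pos1 | pos2 | pos3 | pos4.

(* The index set [d] = {1, ..., d} is represented by 'I_d = {0, ..., d - 1}. *)
Definition range (m n : nat) (s : position) : nat :=
  match s with pos1 | pos3 => m | pos2 | pos4 => n end.

Definition point (m n : nat) : finType := ('I_m * 'I_n * 'I_m * 'I_n)%type.

Definition coord (m n : nat) (s : position) : point m n -> 'I_(range m n s) :=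
  match s with
  | pos1 => fun y => y.1.1.1
  | pos2 => fun y => y.1.1.2
  | pos3 => fun y => y.1.2
  | pos4 => fun y => y.2
  end.

Definition interleaved_array (A : letter_transducer) (m n : nat)
    (q : 'I_m -> states A) (x : 'I_n -> letters A) : {set point m n} :=
  [set y | (q (coord pos1 y), x (coord pos2 y),
            q (coord pos3 y), x (coord pos4 y)) \in transitions A].

(* Only meant for s and t distinct. *)
Definition UT (m n : nat) (s t : position) (Y : {set point m n}) : Prop :=
  #|Y| = m * n /\
  {in Y &, forall y z, coord s y = coord s z -> coord t y = coord t z -> y = z}.

(* Cells may be empty, so this is weaker than [partition] on the set of cells. *)
Record ordered_partition (T : finType) (Y : {set T}) (k : nat) :=
  OrderedPartition {
    cell :> 'I_k -> {set T};
    cell_disjoint : forall i j, i != j -> [disjoint cell i & cell j];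
    cell_cover : \bigcup_(i < k) cell i = Y
  }.

Definition orthogonal (T : finType) (Y : {set T}) (k l : nat)
    (P : ordered_partition Y k) (P' : ordered_partition Y l) : Prop :=
  forall i j, #|P i :&: P' j| = 1.

Section ProperRete.
Variables (m n : nat) (Y : {set point m n}) (s : position).

Definition level_cell (h : 'I_(range m n s)) : {set point m n} :=
  [set y in Y | coord s y == h].

Lemma level_cell_disjoint (h h' : 'I_(range m n s)) :
  h != h' -> [disjoint level_cell h & level_cell h'].
Proof.
move=> neq_hh'; rewrite -setI_eq0; apply/eqP/setP => y; rewrite !inE.
apply/negP => /andP[/andP[_ /eqP yh] /andP[_ /eqP yh']].
by rewrite -yh -yh' eqxx in neq_hh'.
Qed.

Lemma level_cell_cover : \bigcup_h level_cell h = Y.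
Proof.
apply/setP => y; apply/bigcupP/idP => [[h _]|Yy].
  by rewrite inE => /andP[].
by exists (coord s y); rewrite // inE Yy eqxx.
Qed.

Definition level_partition : ordered_partition Y (range m n s) :=
  OrderedPartition level_cell_disjoint level_cell_cover.

End ProperRete.

Definition proper_rete (A : letter_transducer) (m n : nat)
    (q : 'I_m -> states A) (x : 'I_n -> letters A) (s : position) :
    ordered_partition (interleaved_array q x) (range m n s) :=
  level_partition (interleaved_array q x) s.

(* Main.v *)
(* A pair of coordinates (f, g) satisfies the UT condition on a set Y of size
   |I| |J| iff it restricts to a bijection from Y to I x J, iff each of its
   fibres over I x J is a singleton. The fibres are the intersections of cells,
   and the orderings of states and letters carry the array to the transition
   set, so the same fibre condition is the defining property of the transducer. *)
Require Import Defs.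
From mathcomp Require Import all_boot.

Set Implicit Arguments.
Unset Strict Implicit.

Lemma card1_unique (T : finType) (C : {set T}) (P : T -> Prop) :
  (forall y, y \in C <-> P y) -> #|C| = 1 <-> exists! y, P y.
Proof.
move=> CP; split=> [/eqP/cards1P[y Cy]|[y [Py uniq_y]]].
  exists y; split=> [|z /CP]; first by apply/CP; rewrite Cy set11.
  by rewrite Cy => /set1P.
apply/eqP/cards1P; exists y; apply/setP => z; rewrite inE.
by apply/idP/eqP => [/CP/uniq_y //|->]; apply/CP.
Qed.

(** Both sides say that [y |-> (f y, g y)] maps [Y] bijectively onto [I * J]: an injection between
    finite sets of equal size is onto, and a bijection preserves cardinality. *)
Lemma card_inj_fibres (T I J : finType) (Y : {set T}) (f : T -> I) (g : T -> J) :
  (#|Y| = #|I| * #|J| /\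
   {in Y &, forall y z, f y = f z -> g y = g z -> y = z}) <->
  (forall i j, exists! y, [/\ y \in Y, f y = i & g y = j]).
Proof.
pose h y := (f y, g y).
split=> [[cardY inj_fg] i j | fibre1].
  have inj_h : {in Y &, injective h}.
    by move=> y z Yy Yz [fyz gyz]; apply: inj_fg.
  (* Surjectivity by counting: the image of the injection has [#|I| * #|J|] elements. *)
  have imY : h @: Y = setT.
    apply/eqP; rewrite eqEcard subsetT cardsT card_prod.
    by rewrite (card_in_imset inj_h) cardY /=.
  have /imsetP[y Yy [-> ->]] : (i, j) \in h @: Y by rewrite imY inE.
  by exists y; split=> // z [Yz fz gz]; apply: inj_fg.
have inj_fg : {in Y &, forall y z, f y = f z -> g y = g z -> y = z}.
  (* Both [y] and [z] lie in the fibre over [(f z, g z)], hence equal its only point [w]. *)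
  move=> y z Yy Yz fyz gyz; have [w [_ uniq_w]] := fibre1 (f z) (g z).
  by rewrite -(uniq_w y) // -(uniq_w z).
split=> //.
have inj_h : {in Y &, injective h}.
  by move=> y z Yy Yz [fyz gyz]; apply: inj_fg.
rewrite -(card_in_imset inj_h) -card_prod -cardsT; apply: eq_card => -[i j].
rewrite !inE; have [y [[Yy fy gy] _]] := fibre1 i j.
by apply/imsetP; exists y => //; rewrite /h fy gy.
Qed.

(** [phi] carries the fibre over [(i, j)] bijectively onto the fibre over [(a i, b j)], and every
    pair of indices in [I' * J'] has this form. *)
Lemma unique_fibres_bij (T U I I' J J' : Type) (phi : T -> U)
    (a : I -> I') (b : J -> J') (f : T -> I) (g : T -> J)
    (f' : U -> I') (g' : U -> J') (PT : T -> Prop) (PU : U -> Prop) :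
    bijective phi -> bijective a -> bijective b ->
    (forall y, f' (phi y) = a (f y)) -> (forall y, g' (phi y) = b (g y)) ->
    (forall y, PT y <-> PU (phi y)) ->
  (forall i j, exists! e, [/\ PU e, f' e = i & g' e = j]) <->
  (forall i j, exists! y, [/\ PT y, f y = i & g y = j]).
Proof.
move=> [psi phiK psiK] [a' aK a'K] [b' bK b'K] f'E g'E PTE.
split=> fibre1 i j.
  have [e [[Ee fe ge] uniq_e]] := fibre1 (a i) (b j).
  exists (psi e); split=> [|y [/PTE Ey fy gy]].
    split; first by apply/PTE; rewrite psiK.
      by apply: (can_inj aK); rewrite -f'E psiK.
    by apply: (can_inj bK); rewrite -g'E psiK.
  by rewrite (uniq_e (phi y)) ?phiK //; split; rewrite ?f'E ?g'E ?fy ?gy.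
have [y [[Yy fy gy] uniq_y]] := fibre1 (a' i) (b' j).
exists (phi y); split=> [|e [Ee fe ge]].
  by split; [apply/PTE | rewrite f'E fy a'K | rewrite g'E gy b'K].
rewrite (uniq_y (psi e)) ?psiK //; split; first by apply/PTE; rewrite psiK.
  (* Here [i = f' (phi (psi e)) = a (f (psi e))], and [a'] cancels [a]. *)
  by rewrite -fe -[in RHS](psiK e) f'E aK.
by rewrite -ge -[in RHS](psiK e) g'E bK.
Qed.

Lemma UT_sym (m n : nat) (s t : position) (Y : {set point m n}) :
  UT s t Y <-> UT t s Y.
Proof.
by split=> -[cardY inj_st]; split=> // y z Yy Yz eq1 eq2; apply: inj_st.
Qed.

(** The hypothesis identifies the size [m * n] required by [UT] with the number of index pairs; it
    holds when one position is a state and the other a letter. *)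
Lemma UT_unique (m n : nat) (s t : position) (Y : {set point m n}) :
  range m n s * range m n t = m * n ->
  UT s t Y <->
  (forall i j, exists! y, [/\ y \in Y, coord s y = i & coord t y = j]).
Proof.
move=> st; have := card_inj_fibres Y (@coord m n s) (@coord m n t).
by rewrite !card_ord st.
Qed.

Lemma orthogonal_unique (m n : nat) (s t : position) (Y : {set point m n}) :
  orthogonal (level_partition Y s) (level_partition Y t) <->
  (forall i j, exists! y, [/\ y \in Y, coord s y = i & coord t y = j]).
Proof.
have fibre i j y : y \in level_partition Y s i :&: level_partition Y t j <->
    [/\ y \in Y, coord s y = i & coord t y = j].
  rewrite !inE; split=> [/andP[/andP[-> /eqP->] /andP[_ /eqP->]] //|].
  by move=> [-> -> ->]; rewrite !eqxx.
by split=> st i j; apply/(card1_unique (fibre i j)).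
Qed.

Lemma UT_orthogonal (m n : nat) (s t : position) (Y : {set point m n}) :
  range m n s * range m n t = m * n ->
  UT s t Y <-> orthogonal (level_partition Y s) (level_partition Y t).
Proof.
move=> st; apply: (iff_trans (UT_unique Y st)).
by apply: iff_sym; apply: orthogonal_unique.
Qed.

(** The array is the preimage of the transition set under this map. *)
Definition transition_of (A : letter_transducer) (m n : nat)
    (q : 'I_m -> states A) (x : 'I_n -> letters A) (y : point m n) :=
  (q (coord pos1 y), x (coord pos2 y), q (coord pos3 y), x (coord pos4 y)).

Lemma transition_of_bij (A : letter_transducer) (m n : nat)
    (q : 'I_m -> states A) (x : 'I_n -> letters A) :
  bijective q -> bijective x -> bijective (transition_of q x).
Proof.
move=> [q' qK q'K] [x' xK x'K].
exists (fun e => (q' (source e), x' (input e), q' (target e), x' (output e))).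
  by move=> [[[i j] k] l]; rewrite /source /input /target /output /= !qK !xK.
by move=> [[[i j] k] l]; rewrite /transition_of /= !q'K !x'K.
Qed.

Theorem theorem1p1 (m n : nat) (m_gt0 : 0 < m) (n_gt0 : 0 < n)
    (A : letter_transducer)
    (q : 'I_m -> states A) (q_bij : bijective q)
    (x : 'I_n -> letters A) (x_bij : bijective x) :
  let Y := interleaved_array q x in
  let P := proper_rete q x in
  [/\ (mealy A <-> UT pos1 pos2 Y) /\
      (UT pos1 pos2 Y <-> orthogonal (P pos1) (P pos2)),
      (invertible A <-> UT pos4 pos1 Y) /\
      (UT pos4 pos1 Y <-> orthogonal (P pos1) (P pos4)),
      (reversible A <-> UT pos2 pos3 Y) /\
      (UT pos2 pos3 Y <-> orthogonal (P pos2) (P pos3))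
    & (coreversible A <-> UT pos3 pos4 Y) /\
      (UT pos3 pos4 Y <-> orthogonal (P pos3) (P pos4))].
Proof.
move=> Y P.
have phi_bij := transition_of_bij q_bij x_bij.
have YE y : y \in Y <-> transition_of q x y \in transitions A by rewrite inE.
(* All four cases at once: [f] and [g] are the components of a transition at positions [s] and [t],
   and [a] and [b] are the matching orderings among [q] and [x]. *)
have key s t I J (a : 'I_(range m n s) -> I) (b : 'I_(range m n t) -> J) f g :
    range m n s * range m n t = m * n -> bijective a -> bijective b ->
    (forall y, f (transition_of q x y) = a (coord s y)) ->
    (forall y, g (transition_of q x y) = b (coord t y)) ->
    ((forall i j, exists! e, [/\ e \in transitions A, f e = i & g e = j]) <->
     UT s t Y) /\ (UT s t Y <-> orthogonal (P s) (P t)).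
  move=> st a_bij b_bij fE gE; split; last exact: UT_orthogonal.
  apply: iff_trans (iff_sym (UT_unique Y st)).
  exact: unique_fibres_bij phi_bij a_bij b_bij fE gE YE.
(* [invertible] and the orthogonality take position 1 before 4, but the claim is about
   [UT pos4 pos1]; the case is settled for (1, 4) and then swapped. *)
have [invUT UTorth] := key pos1 pos4 _ _ q x (@source A) (@output A)
  erefl q_bij x_bij (fun=> erefl) (fun=> erefl).
have sym41 := UT_sym pos4 pos1 Y.
split.
- by apply: (key pos1 pos2 _ _ q x).
- split; first exact: iff_trans invUT (iff_sym sym41).
  exact: iff_trans sym41 UTorth.
(* With the letter position first, the product of ranges is [n * m]. *)
- by apply: (key pos2 pos3 _ _ x q); rewrite //= mulnC.
- by apply: (key pos3 pos4 _ _ q x).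
Qed.
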